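(* Let $\sigma^2>0$ and let $S\sim\mu$, where $\mu$ is a compactly supported probability law on $[0,\infty)$ with $\mathbb E_\mu[S]>0$. (i) Write $\mu=(1-q)\delta_0+q\nu_+$ with $q\in(0,1]$ and $\nu_+$ a probability law with $\nu_+(\{0\})=0$, and let $G_+(c)=\mathbb E_{\nu_+}[1/(S+c)]$. Then, for $\omega>0$ and $c=\sigma^2/\omega$, $$L_\mu(\omega)=\frac{(1-q)\omega+q\sigma^2G_+(c)}{q(1-cG_+(c))}.$$ In particular, if $q<1$ then $L_\mu(\omega)\sim\frac{1-q}{q}\,\omega$ as $\omega\to\infty$. (ii) Suppose $\mathbb P(S=0)=0$. If $\mathbb E[S^{-1}]<\infty$, then $L_\mu(\omega)\to\sigma^2\mathbb E[S^{-1}]$ as $\omega\to\infty$. (iii) Suppose $\mathbb P(S=0)=0$ and $\mu$ has a density $f$ with $f(s)=Cs^\alpha+o(s^\alpha)$ as $s\downarrow0$, for some $C>0$ and $\alpha>-1$. If $\alpha=0$, then $L_\mu(\omega)\sim\sigma^2C\log(\omega/\sigma^2)$ as $\omega\to\infty$. If $-1<\alpha<0$, then, as $\omega\to\infty$, $$L_\mu(\omega)\sim\sigma^2C\Big(\frac{\sigma^2}{\omega}\Big)^{\alpha}\frac{\pi}{\sin(\pi(\alpha+1))}$$ (here $\pi$ is the number $3.14\ldots$). If $\alpha>0$, then $\mathbb E[S^{-1}]<\infty$, so that (ii) applies.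
   Context: For $\omega>0$, $L_\mu(\omega)=\mathbb E_\mu\big[\frac{\sigma^2\omega}{\sigma^2+\omega S}\big]\big/\mathbb E_\mu\big[\frac{\omega S}{\sigma^2+\omega S}\big]$. $a(\omega)\sim b(\omega)$ means $a(\omega)/b(\omega)\to1$. *)

(* Defs.v *)
From mathcomp Require Export all_boot all_order all_algebra.
From mathcomp Require Export all_classical all_reals all_analysis.

Set Implicit Arguments.
Unset Strict Implicit.
Unset Printing Implicit Defensive.

Import Order.TTheory GRing.Theory Num.Theory.
Import numFieldNormedType.Exports.

Local Open Scope classical_set_scope.
Local Open Scope ring_scope.

(* A law on R carried by some compact subset of [0, +oo[. *)
Definition compactly_supported_on_nonneg (R : realType)
    (mu : probability (measurableTypeR R) R) : Prop :=
  exists K : set R, [/\ compact K, K `<=` `[0, +oo[ & mu K = 1%E].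

(* The variable S of law mu is the coordinate s on R: the expectation of g(S)
   is 'E_mu[g]. On [0, +oo[ both integrands are bounded when 0 < sigma2 and
   0 < w, so that [fine] loses nothing. *)
Definition L (R : realType) (sigma2 : R)
    (mu : probability (measurableTypeR R) R) (w : R) : R :=
  fine 'E_mu[fun s : R => (sigma2 * w / (sigma2 + w * s))%R] /
  fine 'E_mu[fun s : R => (w * s / (sigma2 + w * s))%R].

Definition G (R : realType) (nu : probability (measurableTypeR R) R) (c : R)
    : R :=
  fine 'E_nu[fun s : R => ((s + c)^-1)%R].

(* mu = (1 - q) delta_0 + q nu, where nu has no atom at 0 *)
Definition zero_atom_decomposition (R : realType)
    (mu : probability (measurableTypeR R) R) (q : R)
    (nu : probability (measurableTypeR R) R) : Prop :=
  [/\ 0 < q, q <= 1, nu [set 0] = 0%E &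
      forall A : set (measurableTypeR R), measurable A ->
        mu A = ((1 - q)%:E * \d_(0%R : R) A + q%:E * nu A)%E].

Definition has_density (R : realType)
    (mu : probability (measurableTypeR R) R) (f : R -> R) : Prop :=
  [/\ measurable_fun [set: R] f, (forall s, 0 <= f s) &
      forall A : set (measurableTypeR R), measurable A ->
        mu A = (\int[lebesgue_measure]_(s in A) (f s)%:E)%E].

(* a(w) ~ b(w) as w -> +oo, in the sense a(w) / b(w) -> 1. Since x / 0 = 0,
   this forces b(w) != 0 for all large w. *)
Definition equiv_at_infty (R : realType) (a b : R -> R) : Prop :=
  a w / b w @[w --> +oo] --> (1 : R).

(* Main.v *)
(** Put [c = sigma2 / w] and let [G] be the Stieltjes transform.  Both
    expectations in [L] are affine in [G c], which gives (i), and for a law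
    without atom at 0 it gives [L = sigma2 * G c / (1 - c * G c)] with
    [c * G c -> 0] by dominated convergence.  So everything reduces to the
    behaviour of [G c] as [c -> 0]: dominated convergence for (ii), and for
    (iii) comparison of the density with [C * s^alpha] on a small [(0, d)], the
    rest of the law contributing at most [1 / d].

    The constant for [-1 < alpha < 0] comes from
    [int_0^oo s^(a-1) / (s + c) ds = c^(a-1) * pi / sin (pi a)].  Expanding
    [1 / (s + c)] geometrically on both sides of [s = c] turns this into the
    partial fraction series of [pi / sin (pi a)], which is obtained by a
    Herglotz argument: the partial sums
    [sum_(k < N) (1 / (k + a) - 1 / (k + 1 - a))] satisfy exactly the
    duplication formula of [pi cot (pi a)] (with [N] doubled), so the difference
    of the two, Lipschitz for [N = 1], tends to 0 along the powers of 2. *)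

Require Import Defs.
From mathcomp Require Import measurable_realfun ring lra.

Set Implicit Arguments.
Unset Strict Implicit.
Unset Printing Implicit Defensive.

Import Order.TTheory GRing.Theory Num.Theory.
Import numFieldNormedType.Exports.

Local Open Scope classical_set_scope.
Local Open Scope ring_scope.

(** * The partial fractions of the cosecant *)

(** The series of [pi cot (pi a)], with terms [1 / (n + a)] over all integers [n], is truncated to
    [-N <= n < N], and [n = k] is paired with [n = -k - 1]. This range makes each term antisymmetric
    about [1/2] and the duplication formula exact. *)
Definition cot_sum (R : realType) (N : nat) (a : R) : R :=
  \sum_(k < N) ((k%:R + a)^-1 - (k%:R + 1 - a)^-1).

Definition csc_sum (R : realType) (N : nat) (a : R) : R :=
  \sum_(k < N) (-1) ^+ k * ((k%:R + a)^-1 + (k%:R + 1 - a)^-1).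

(** Halving the argument doubles each term and its index: [a / 2] produces the denominators [2k + a]
    and [2k + 2 - a], and [(a + 1) / 2] produces [2k + 1 + a] and [2k + 1 - a]. *)
Lemma cot_sum_duplication (R : realType) (N : nat) (a : R) : 0 < a < 1 ->
  cot_sum N (a / 2) + cot_sum N ((a + 1) / 2) = 2 * cot_sum N.*2 a.
Proof.
move=> /andP[a0 a1]; rewrite /cot_sum.
elim: N => [|N IH]; first by rewrite double0 !big_ord0 addr0 mulr0.
rewrite doubleS !big_ord_recr/= addrACA IH !mulrDr -!addrA; congr +%R.
rewrite -muln2 -(natr1 (N * 2)) natrM; have : 0 <= N%:R :> R by [].
move: (N%:R : R) => x x0.
field; do ?[apply/andP; split]; lra.
Qed.

(** Finite form of [1 / sin x = cot (x / 2) - cot x]: the first sum contains every second term of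
    [cot_sum N.*2 a] twice, so subtracting all terms once leaves alternating signs. *)
Lemma csc_sum_cot_sum (R : realType) (N : nat) (a : R) : 0 < a < 1 ->
  csc_sum N.*2 a = cot_sum N (a / 2) - cot_sum N.*2 a.
Proof.
move=> /andP[a0 a1]; rewrite /cot_sum /csc_sum.
elim: N => [|N IH]; first by rewrite double0 !big_ord0 subr0.
rewrite doubleS !big_ord_recr/= IH exprS -muln2 mulnC exprM sqrrN !expr1n.
rewrite -(natr1 (2 * N)) natrM; have : 0 <= N%:R :> R by [].
move: (N%:R : R) => x x0.
move: (\sum_(k < N) _) (\sum_(k < 2 * N) _) => A B.
field; do ?[apply/andP; split]; lra.
Qed.

Lemma mean_value_segment (R : realType) (f df : R -> R) (a b : R) : a <= b ->
  (forall x, a <= x <= b -> is_derive x 1 f (df x)) ->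
  exists2 c, a <= c <= b & f b - f a = df c * (b - a).
Proof.
move=> ab fdf; have [x||c cab ->] := @MVT_segment R f df a b ab.
- by rewrite in_itv/= => /andP[ax xb]; apply: fdf; rewrite !ltW.
- apply: derivable_within_continuous => x; rewrite in_itv/= => xab.
  by have [] := fdf _ xab.
- by exists c => //; move: cab; rewrite in_itv.
Qed.

Lemma sin_le_id (R : realType) (x : R) : 0 <= x -> sin x <= x.
Proof.
move=> x0.
have [c _] := @mean_value_segment R (fun x => x - sin x) (fun x => 1 - cos x) 0 x x0
  (fun y _ => ltac:(exact: is_deriveB)).
by rewrite sin0 !subr0 => h; rewrite -subr_ge0 h mulr_ge0.
Qed.

Lemma mulr_cos_le_sin (R : realType) (x : R) : 0 <= x <= pi -> x * cos x <= sin x.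
Proof.
move=> /andP[x0 xpi].
have [c /andP[c0 cx]] := @mean_value_segment R (fun x => sin x - x * cos x)
  (fun x => x * sin x) 0 x x0
  (fun y _ => ltac:(by apply: is_derive_eq; rewrite /GRing.scale/=; ring)).
rewrite sin0 mul0r !subr0 => h; rewrite -subr_ge0 h !mulr_ge0//.
by apply: sin_ge0_pi; rewrite c0 (le_trans cx).
Qed.

(** Moving from [x / 2] to [(x + 1) / 2] shifts the angle by [pi / 2] and turns the cotangent into
    minus the tangent; then [cot y - tan y = 2 cot (2y)]. *)
Lemma picot_duplication (R : realType) (x : R) : 0 < x < 1 ->
  let picot y := pi * (cos (pi * y) / sin (pi * y)) in
  picot (x / 2) + picot ((x + 1) / 2) = 2 * picot x.
Proof.
move=> /andP[x0 x1] /=; have p0 := pi_gt0 R.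
rewrite (_ : pi * ((x + 1) / 2) = pi * (x / 2) + pi / 2); last by field.
rewrite (_ : pi * x = (pi * (x / 2)) *+ 2); last by rewrite mulr2n; field.
rewrite cosDpihalf sinDpihalf cos_mulr2n sin_mulr2n.
have hx : 0 < pi * (x / 2) < pi / 2.
  by apply/andP; split; [nra | nra].
have s0 := sin_gt0_pihalf hx.
have c0 : 0 < cos (pi * (x / 2)).
  by apply: cos_gt0_pihalf; case/andP: hx => *; apply/andP; split; lra.
have := cos2Dsin2 (pi * (x / 2)).
move: (cos _) (sin _) s0 c0 => c s s0 c0 sc.
rewrite -[X in _ - X]sc; field; rewrite !gt_eqF//.
Qed.

Lemma picot_csc (R : realType) (x : R) : 0 < x < 1 ->
  pi * (cos (pi * (x / 2)) / sin (pi * (x / 2)))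
    - pi * (cos (pi * x) / sin (pi * x)) = pi / sin (pi * x).
Proof.
move=> /andP[x0 x1] /=; have p0 := pi_gt0 R.
rewrite (_ : pi * x = (pi * (x / 2)) *+ 2); last by rewrite mulr2n; field.
rewrite cos_mulr2n sin_mulr2n.
have hx : 0 < pi * (x / 2) < pi / 2.
  by apply/andP; split; [nra | nra].
have s0 := sin_gt0_pihalf hx.
have c0 : 0 < cos (pi * (x / 2)).
  by apply: cos_gt0_pihalf; case/andP: hx => *; apply/andP; split; lra.
by field; rewrite !gt_eqF.
Qed.

(** With [y = pi x], the lower bound is [sin y <= y]. The upper bound amounts to
    [y^2 - sin^2 y <= y^2 sin^2 y], that is [(y cos y)^2 <= (sin y)^2]; the range [x <= 1/2] keeps
    [cos y] nonnegative so that squaring is monotone. *)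
Lemma pisin2_bound (R : realType) (x : R) : 0 < x <= 2^-1 ->
  0 <= (pi / sin (pi * x)) ^+ 2 - x ^- 2 <= pi ^+ 2.
Proof.
move=> /andP[x0 x1]; have p0 := pi_gt0 R.
have px0 : 0 < pi * x by rewrite mulr_gt0.
have pxpi : pi * x < pi by rewrite -[ltRHS]mulr1 ltr_pM2l//; lra.
have s0 : 0 < sin (pi * x) by apply: sin_gt0_pi; rewrite px0.
have c0 : 0 <= cos (pi * x).
  apply: cos_ge0_pihalf; have := ler_wpM2l (ltW p0) x1; lra.
have sx : sin (pi * x) <= pi * x by rewrite sin_le_id// ltW.
have cx : pi * x * cos (pi * x) <= sin (pi * x).
  by rewrite mulr_cos_le_sin// !ltW.
have := cos2Dsin2 (pi * x); move: (sin _) (cos _) s0 c0 sx cx => s c s0 c0 sx cx sc.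
have -> : (pi / s) ^+ 2 - x ^- 2 = ((pi * x) ^+ 2 - s ^+ 2) / (x * s) ^+ 2.
  by field; rewrite !gt_eqF.
have xs0 : 0 < (x * s) ^+ 2 by rewrite exprn_gt0// mulr_gt0.
rewrite divr_ge0 ?(ltW xs0)/= ?ler_pdivrMr//; last by rewrite subr_ge0 lerXn2r ?nnegrE// ltW.
have : (pi * x * c) ^+ 2 <= s ^+ 2.
  by rewrite lerXn2r ?nnegrE ?mulr_ge0 ?(ltW p0) ?(ltW x0) ?(ltW s0).
rewrite !exprMn => h.
have s2 : s ^+ 2 = 1 - c ^+ 2 by rewrite -sc addrC addKr.
rewrite s2 in h *; lra.
Qed.

(** The poles of the cotangent at 0 and 1 are cancelled by the two fractions, so the difference has
    a bounded derivative on the open interval. *)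
Lemma cot_sum1_lipschitz (R : realType) (a b : R) : 0 < a < 1 -> 0 < b < 1 ->
  `|(a^-1 - (1 - a)^-1 - pi * (cos (pi * a) / sin (pi * a))) -
    (b^-1 - (1 - b)^-1 - pi * (cos (pi * b) / sin (pi * b)))|
  <= (4 + pi ^+ 2) * `|a - b|.
Proof.
wlog ab : a b / a <= b => [wlg a01 b01|].
  have [ab|/ltW ba] := leP a b; first exact: wlg.
  by rewrite distrC (distrC a) wlg.
move=> /andP[a0 a1] /andP[b0 b1]; have p0 := pi_gt0 R.
pose f x : R := x^-1 - (1 - x)^-1 - pi * (cos (pi * x) / sin (pi * x)).
pose df x : R := (pi / sin (pi * x)) ^+ 2 - x ^- 2 - (1 - x) ^- 2.
have s0 (x : R) : 0 < x < 1 -> 0 < sin (pi * x).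
  move=> /andP[x0 x1]; apply: sin_gt0_pi.
  by apply/andP; split; nra.
have [x /andP[ax xb]|c /andP[ac cb]] := @mean_value_segment R f df a b ab.
  have x0 : x != 0 by rewrite gt_eqF// (lt_le_trans a0).
  have x1 : 1 - x != 0 by rewrite gt_eqF// subr_gt0 (le_lt_trans xb).
  have sx : sin (pi * x) != 0.
    by rewrite gt_eqF// s0// (lt_le_trans a0)//= (le_lt_trans xb).
  have := cos2Dsin2 (pi * x) => sc.
  have := @is_deriveV R id x _ _ x0 (is_derive_id x 1) => d1.
  have := @is_deriveV R (fun y => 1 - y) x _ _ x1 _ => /(_ _ _ (is_deriveB _ _)) d2.
  have d3 := @is_deriveV R (fun y => sin (pi * y)) x _ _ sx _.
  apply: is_derive_eq.
  rewrite /GRing.scale/= /df.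
  have -> : (pi / sin (pi * x)) ^+ 2 =
      pi ^+ 2 * (cos (pi * x) ^+ 2 + sin (pi * x) ^+ 2) / sin (pi * x) ^+ 2.
    by rewrite sc mulr1 expr_div_n.
  by field; rewrite x0 x1 sx.
rewrite distrC -/(f a) -/(f b) => ->.
have c0 : 0 < c by exact: lt_le_trans ac.
have c1 : c < 1 by exact: le_lt_trans b1.
rewrite normrM (distrC a) ler_wpM2r// /df.
(* The derivative is invariant under [c -> 1 - c]. For [c <= 1/2] its first two terms lie in
   [[0, pi^2]] and [(1 - c)^-2] lies in [[0, 4]]. *)
wlog ch : c c0 c1 {ac cb} / c <= 2^-1 => [wlg|].
  have [ch|ch] := leP c 2^-1; first exact: wlg.
  have := wlg (1 - c); rewrite subKr mulrBr mulr1.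
  rewrite (sinB pi) sinpi cospi mul0r mulN1r add0r opprK => h.
  rewrite addrAC; apply: h; lra.
have /andP[l u] := @pisin2_bound R c (introT andP (conj c0 ch)).
have i0 : 0 <= (1 - c) ^- 2 by rewrite invr_ge0 sqr_ge0.
have i4 : (1 - c) ^- 2 <= 4.
  rewrite -[leRHS]invrK lef_pV2 ?posrE ?invr_gt0 ?exprn_gt0//; nra.
rewrite ler_norml; apply/andP; split; nra.
Qed.

(* The duplication formula halves the Lipschitz constant of the difference at
   each doubling of the number of terms, and the difference vanishes at 1/2. *)
Lemma cot_sum_pow2_bound (R : realType) (n : nat) (a : R) : 0 < a < 1 ->
  `|cot_sum (2 ^ n) a - pi * (cos (pi * a) / sin (pi * a))|
  <= (4 + pi ^+ 2) / 2 ^+ n.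
Proof.
pose D N x : R := cot_sum N x - pi * (cos (pi * x) / sin (pi * x)).
have D2 N (x : R) : 0 < x < 1 -> D N.*2 x = (D N (x / 2) + D N ((x + 1) / 2)) / 2.
  move=> x01; have := cot_sum_duplication N x01; have := picot_duplication x01.
  rewrite /D /=; lra.
have p0 := pi_gt0 R.
have lip m (x y : R) : 0 < x < 1 -> 0 < y < 1 ->
    `|D (2 ^ m)%N x - D (2 ^ m)%N y| <= (4 + pi ^+ 2) / 2 ^+ m * `|x - y|.
  elim: m x y => [|m IH] x y x01 y01.
    have := cot_sum1_lipschitz x01 y01.
    by rewrite expr0 divr1 /D /cot_sum expn0 !big_ord1 !add0r.
  rewrite expnS mul2n !D2//.
  have half (z : R) : 0 < z < 1 -> 0 < z / 2 < 1 /\ 0 < (z + 1) / 2 < 1.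
    by move=> /andP[z0 z1]; split; apply/andP; split; lra.
  have [hx hx'] := half _ x01; have [hy hy'] := half _ y01.
  rewrite -mulrBl normrM opprD addrACA.
  have := lerD (IH _ _ hx hy) (IH _ _ hx' hy').
  rewrite -!mulrBl !normrM (_ : x + 1 - (y + 1) = x - y); last by ring.
  rewrite [`|2^-1|]ger0_norm// (exprS _ m) invfM.
  have := ler_normD (D (2 ^ m)%N (x / 2) - D (2 ^ m)%N (y / 2))
    (D (2 ^ m)%N ((x + 1) / 2) - D (2 ^ m)%N ((y + 1) / 2)).
  move: (`|_|) => p; move: (`|_| + _) => q; lra.
move=> a01; have h01 : 0 < (2^-1 : R) < 1 by apply/andP; split; lra.
have D0 : D (2 ^ n)%N 2^-1 = 0.
  rewrite /D cos_pihalf mul0r mulr0 subr0 /cot_sum big1// => k _.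
  by rewrite (_ : k%:R + 1 - 2^-1 = k%:R + 2^-1 :> R) ?subrr//; lra.
have := lip n _ _ a01 h01; rewrite D0 subr0 => /le_trans; apply.
rewrite ler_piMr// ?divr_ge0 ?addr_ge0 ?sqr_ge0 ?exprn_ge0//.
case/andP: a01 => *; rewrite ler_norml; apply/andP; split; lra.
Qed.

(** The relation between cosecant and cotangent holds both for the partial sums and for the
    functions, so the error is at most that of [2 ^ n] terms at [a / 2] plus that of [2 ^ n.+1]
    terms at [a]. *)
Lemma csc_sum_cvg (R : realType) (a : R) : 0 < a < 1 ->
  csc_sum (2 ^ n.+1) a @[n --> \oo] --> pi / sin (pi * a).
Proof.
move=> a01; have h01 : 0 < a / 2 < 1 by case/andP: a01 => *; apply/andP; split; lra.
apply/cvgrPdist_le => e e0.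
have : (4 + pi ^+ 2) * 2 * (2^-1 ^+ n) @[n --> \oo] --> (4 + pi ^+ 2) * 2 * (0 : R).
  apply: cvgMl_tmp; apply: cvg_expr; rewrite ger0_norm//; lra.
rewrite mulr0 => /cvgrPdist_le/(_ _ e0); apply: filterS => n.
rewrite sub0r normrN ger0_norm ?mulr_ge0 ?addr_ge0 ?sqr_ge0 ?exprn_ge0// exprVn.
move=> h; apply: le_trans h.
rewrite -picot_csc// expnS mul2n csc_sum_cot_sum// -mul2n -expnS.
have := cot_sum_pow2_bound n h01; have := cot_sum_pow2_bound n.+1 a01.
rewrite (exprS _ n) invfM.
have : 0 <= (4 + pi ^+ 2) * (2 ^+ n)^-1 :> R by rewrite divr_ge0 ?addr_ge0 ?sqr_ge0 ?exprn_ge0.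
move: (cot_sum _ _) (cot_sum _ _) (pi * _) (pi * _) => A B c d.
rewrite !ler_norml => ? /andP[? ?] /andP[? ?]; apply/andP; split; lra.
Qed.

(** * Power integrals and the Stieltjes transform of a power *)

Lemma integral_segment_derive (R : realType) (F f : R -> R) (a b : R) : a <= b ->
  (forall s, a <= s <= b -> is_derive s 1 F (f s)) ->
  (forall s, a <= s <= b -> {for s, continuous f}) ->
  (\int[lebesgue_measure]_(s in `[a, b]) (f s)%:E = (F b - F a)%:E)%E.
Proof.
rewrite le_eqVlt => /predU1P[->|ab] dF cf.
  by rewrite set_itv1 integral_set1 subrr.
have dF1 s : a <= s <= b -> derivable F s 1 by move=> /dF[].
have cF s : a <= s <= b -> {for s, continuous F}.
  by move=> /dF1 ?; apply/differentiable_continuous; rewrite -derivable1_diffP.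
rewrite (@continuous_FTC2 _ _ F) ?EFinB//.
- by apply: continuous_in_subspaceT => s; rewrite inE/= in_itv/=; exact: cf.
- split => [s||].
  + by rewrite in_itv/= => /andP[as_ sb]; apply: dF1; rewrite !ltW.
  + by apply: cvg_at_right_filter; apply: cF; rewrite lexx ltW.
  + by apply: cvg_at_left_filter; apply: cF; rewrite lexx ltW.
- move=> s; rewrite in_itv/= => /andP[as_ sb]; rewrite derive1E.
  by have [] := dF s (introT andP (conj (ltW as_) (ltW sb))).
Qed.

Lemma integral_powR_segment (R : realType) (p a b : R) : p != 0 -> 0 < a <= b ->
  (\int[lebesgue_measure]_(s in `[a, b]) (s `^ (p - 1))%:E =
   ((b `^ p - a `^ p) / p)%:E)%E.
Proof.
move=> p0 /andP[a0 ab].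
have s0 s : a <= s <= b -> 0 < s by move=> /andP[/(lt_le_trans a0)].
apply: etrans (integral_segment_derive (F := fun x => p^-1 * x `^ p) ab _ _) _.
- move=> s /s0 /(is_derive1_powR p) ?; apply: is_derive_eq.
  by rewrite /GRing.scale/=; field.
- move=> s /s0 ?; apply/differentiable_continuous; rewrite -derivable1_diffP.
  by apply: derivable_powR; rewrite in_itv/= andbT.
- by rewrite -mulrBr mulrC.
Qed.

(** Monotone convergence along segments [[b / (i + 1), b]], which avoid the possible singularity at
    0. *)
Lemma integral_powR_itvoc (R : realType) (p b : R) : 0 < p -> 0 < b ->
  (\int[lebesgue_measure]_(s in `]0%R, b]) (s `^ (p - 1))%:E = (b `^ p / p)%:E)%E.
Proof.
move=> p0 b0; pose F i : set R := `[b / i.+1%:R, b]%classic.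
have bi i : 0 < b / i.+1%:R <= b.
  by rewrite divr_gt0//= ler_pdivrMr// ler_peMr ?ler1n// ltW.
have UF : \bigcup_i F i = `]0, b]%classic.
  apply/seteqP; split => [x [i _]|x]; rewrite /F /= !in_itv/=.
    by have /andP[bi0 _] := bi i => /andP[ix ->]; rewrite (lt_le_trans bi0).
  (* This index satisfies [b / x < i + 1], hence [b / (i + 1) <= x]. *)
  move=> /andP[x0 xb]; exists (Num.trunc (b / x)) => //=.
  rewrite in_itv/= xb andbT ler_pdivrMr// mulrC -ler_pdivrMr// ltW//.
  exact: truncnS_gt.
have Fb : (\int[lebesgue_measure]_(s in F i) (s `^ (p - 1))%:E)%E @[i --> \oo]
    --> (\int[lebesgue_measure]_(s in `]0%R, b]) (s `^ (p - 1))%:E)%E.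
  rewrite -UF; apply: ge0_nondecreasing_set_cvg_integral.
  - move=> m n mn; apply/subsetPset => x; rewrite /F /= !in_itv/=.
    move=> /andP[mx ->]; rewrite andbT (le_trans _ mx)// ler_pM2l//.
    by rewrite lef_pV2 ?posrE// ler_nat.
  - by move=> i; exact: measurable_itv.
  - by move=> i; apply/measurable_EFinP/measurable_funTS; exact: measurable_powR.
  - by move=> i x _; rewrite lee_fin powR_ge0.
rewrite -(cvg_lim _ Fb)//; apply: cvg_lim => //.
under eq_fun do rewrite integral_powR_segment ?gt_eqF//.
apply: cvg_EFin; first exact: nearW.
apply: cvgMr_tmp.
rewrite -[X in _ --> X]subr0; apply: cvgB; first exact: cvg_cst.
move/cvg_at_rightP : (powR_cvg0 p0); apply; split; first by move=> n; rewrite divr_gt0.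
by rewrite -[X in _ --> X](mulr0 b); apply: cvgMl_tmp; exact: cvg_harmonic.
Qed.

Lemma integral_powR_itvcy (R : realType) (p a : R) : 0 < p -> 0 < a ->
  (\int[lebesgue_measure]_(s in `[a, +oo[) (s `^ (- p - 1))%:E =
   (a `^ (- p) / p)%:E)%E.
Proof.
move=> p0 a0; pose F i : set R := `[a, a * i.+1%:R]%classic.
have ai i : 0 < a <= a * i.+1%:R.
  by rewrite a0/= ler_peMr ?ler1n// ltW.
have UF : \bigcup_i F i = `[a, +oo[%classic.
  apply/seteqP; split => [x [i _]|x]; rewrite /F /= !in_itv/=.
    by move=> /andP[->].
  rewrite andbT => ax; exists (Num.trunc (x / a)) => //=.
  rewrite in_itv/= ax/= mulrC -ler_pdivrMr// ltW//.
  exact: truncnS_gt.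
have Fa : (\int[lebesgue_measure]_(s in F i) (s `^ (- p - 1))%:E)%E @[i --> \oo]
    --> (\int[lebesgue_measure]_(s in `[a, +oo[) (s `^ (- p - 1))%:E)%E.
  rewrite -UF; apply: ge0_nondecreasing_set_cvg_integral.
  - move=> m n mn; apply/subsetPset => x; rewrite /F /= !in_itv/=.
    by move=> /andP[-> /le_trans]; apply; rewrite ler_pM2l// ler_nat.
  - by move=> i; exact: measurable_itv.
  - by move=> i; apply/measurable_EFinP/measurable_funTS; exact: measurable_powR.
  - by move=> i x _; rewrite lee_fin powR_ge0.
rewrite -(cvg_lim _ Fa)//; apply: cvg_lim => //.
under eq_fun do rewrite integral_powR_segment ?oppr_eq0 ?gt_eqF//.
apply: cvg_EFin; first exact: nearW.
rewrite (_ : a `^ (- p) / p = (0 - a `^ (- p)) / - p); last first.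
  by rewrite sub0r invrN mulrNN.
apply: cvgMr_tmp; apply: cvgB; last exact: cvg_cst.
(* The endpoint term is rewritten as the positive power [p] of [1 / (a (i + 1))], which tends to 0
   from the right. *)
under eq_fun do rewrite -mulN1r powRrM powR_inv1 ?mulr_ge0 ?(ltW a0)//.
move/cvg_at_rightP : (powR_cvg0 p0); apply; split.
  by move=> n; rewrite invr_gt0 mulr_gt0.
suff : a^-1 * harmonic i @[i --> \oo] --> a^-1 * 0.
  by rewrite mulr0; under eq_fun do rewrite -invfM.
by apply: cvgMl_tmp; exact: cvg_harmonic.
Qed.

(** The inverse is written as [x] times a real power of [x^2], both measurable; at 0 the factor [x]
    matches the convention that the inverse of 0 is 0. *)
Lemma measurable_fun_invr (R : realType) : measurable_fun [set: R] (@GRing.inv R).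
Proof.
rewrite (_ : GRing.inv = fun x : R => x * (x ^+ 2) `^ (-1)).
  apply: measurable_funM => //.
  apply: (measurableT_comp (measurable_powR (-1))).
  exact: measurable_funX.
apply/funext => x; rewrite powR_inv1 ?sqr_ge0//.
have [->|x0] := eqVneq x 0; first by rewrite invr0 mul0r.
by rewrite expr2 invfM mulrA mulfV// mul1r.
Qed.

Lemma measurable_fun_invDr (R : realType) (c : R) :
  measurable_fun [set: R] (fun s : R => (s + c)^-1).
Proof.
exact: (measurableT_comp (@measurable_fun_invr R) (measurable_funD _ _)).
Qed.

(* Unrolling the recursion gives [w 0] as the alternating sum of the pairwise
   sums up to an error [w N], itself at most the [N]-th pairwise sum. *)
Lemma csc_recursion (R : realType) (a : R) (w : nat -> R) : 0 < a < 1 ->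
  (forall k, 0 <= w k) ->
  (forall k, w k + w k.+1 = (k%:R + a)^-1 + (k%:R + 1 - a)^-1) ->
  w 0%N = pi / sin (pi * a).
Proof.
move=> a01 w0 wS; have wsum N : w 0%N = csc_sum N a + (-1) ^+ N * w N.
  elim: N => [|N IH]; first by rewrite /csc_sum big_ord0 add0r mul1r.
  rewrite IH /csc_sum big_ord_recr/= -addrA -wS exprS; congr +%R; ring.
rewrite -(cvg_lim _ (csc_sum_cvg a01))//; apply/esym/cvg_lim => //.
apply/cvgrPdist_le => e e0.
have : (2^-1 ^+ n * 2 : R) @[n --> \oo] --> 0 * (2 : R).
  apply: cvgMr_tmp; apply: cvg_expr; rewrite ger0_norm//; lra.
rewrite mul0r => /cvgrPdist_le/(_ _ e0); apply: filterS => n.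
rewrite sub0r normrN ger0_norm ?mulr_ge0 ?exprn_ge0// => h; apply: le_trans h.
rewrite (wsum (2 ^ n.+1)%N) [csc_sum _ _ + _]addrC addrK normrM normrX normrN1 expr1n.
rewrite mul1r ger0_norm// exprVn.
set N := (2 ^ n.+1)%N; have := wS N; have := w0 N.+1 => ? ?.
have N2 : N%:R = 2 * 2 ^+ n :> R by rewrite /N natrX exprS.
have p1 : 1 <= 2 ^+ n :> R by rewrite exprn_ege1//; lra.
have [a0 a1] := andP a01.
have h1 : (N%:R + a)^-1 <= (2 ^+ n)^-1.
  rewrite lef_pV2 ?posrE; lra.
have h2 : (N%:R + 1 - a)^-1 <= (2 ^+ n)^-1.
  rewrite lef_pV2 ?posrE; lra.
lra.
Qed.

(** Only the sums of consecutive functions have known integrals. By nonnegativity each single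
    integral is dominated by such a sum, hence finite, so the recursion can be read in the reals. *)
Lemma ge0_integral_recursion d (T : measurableType d) (R : realType)
    (m : {measure set T -> \bar R}) (A : set T) (f : nat -> T -> R) (r : nat -> R) :
  measurable A -> (forall k, measurable_fun A (f k)) ->
  (forall k x, A x -> 0 <= f k x) ->
  (forall k, (\int[m]_(x in A) (f k x + f k.+1 x)%:E = (r k)%:E)%E) ->
  exists u : nat -> R, forall k,
    [/\ 0 <= u k, (\int[m]_(x in A) (f k x)%:E = (u k)%:E)%E &
        u k + u k.+1 = r k].
Proof.
move=> mA mf f0 fr.
pose I k := (\int[m]_(x in A) (f k x)%:E)%E.
have I0 k : (0 <= I k)%E by apply: integral_ge0 => x Ax; rewrite lee_fin f0.
have IS k : (I k + I k.+1 = (r k)%:E)%E.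
  rewrite -fr /I -ge0_integralD//.
  - by move=> x Ax; rewrite lee_fin f0.
  - exact/measurable_EFinP.
  - by move=> x Ax; rewrite lee_fin f0.
  - exact/measurable_EFinP.
have Ifin k : I k \is a fin_num.
  rewrite ge0_fin_numE// (@le_lt_trans _ _ (r k)%:E) ?ltry// -IS.
  by rewrite leeDl.
exists (fine \o I) => k /=; split; first by rewrite fine_ge0.
- by rewrite fineK ?Ifin.
- by have := IS k; rewrite -(fineK (Ifin k)) -(fineK (Ifin k.+1)) -EFinD => -[].
Qed.

Lemma integral_powR_stieltjes (R : realType) (a c : R) : 0 < a < 1 -> 0 < c ->
  (\int[lebesgue_measure]_(s in `]0%R, +oo[) (s `^ (a - 1) / (s + c))%:E =
   (c `^ (a - 1) * (pi / sin (pi * a)))%:E)%E.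
Proof.
move=> a01 c0; have [a0 a1] := andP a01.
(* [1 / (s + c)] is expanded in powers of [s / c] below [c] and of [c / s]
   above; [U k] and [V k] are the [k]-th remainders, normalised so that their
   integrals do not depend on [c]. *)
pose U (k : nat) (s : R) := c `^ (1 - a - k%:R) * s `^ (a - 1 + k%:R) / (s + c).
pose V (k : nat) (s : R) := c `^ (1 - a + k%:R) * s `^ (a - 1 - k%:R) / (s + c).
have mU A k : measurable_fun A (U k).
  apply/measurable_funTS/measurable_funM; last exact: measurable_fun_invDr.
  by apply: measurable_funM => //; exact: measurable_powR.
have mV A k : measurable_fun A (V k).
  apply/measurable_funTS/measurable_funM; last exact: measurable_fun_invDr.
  by apply: measurable_funM => //; exact: measurable_powR.
have U0 k s : `]0, c]%classic s -> 0 <= U k s.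
  rewrite /= in_itv/= => /andP[s0 _].
  by rewrite /U !mulr_ge0 ?powR_ge0 ?invr_ge0 ?addr_ge0 ?ltW.
have V0 k s : `[c, +oo[%classic s -> 0 <= V k s.
  rewrite /= in_itv/= andbT => s0; have {}s0 := lt_le_trans c0 s0.
  by rewrite /V !mulr_ge0 ?powR_ge0 ?invr_ge0 ?addr_ge0 ?ltW.
(* Passing from [k] to [k + 1] multiplies [U] by [s / c], and [1 + s / c] cancels the denominator
   [s + c], leaving a pure power. The same holds for [V] with the ratio [c / s]. *)
have addU k s : 0 < s -> U k s + U k.+1 s = c `^ (- (a + k%:R)) * s `^ (a + k%:R - 1).
  move=> s0; rewrite /U -natr1.
  rewrite (_ : 1 - a - k%:R = 1 - (a + k%:R)); last by ring.
  rewrite (_ : 1 - a - (k%:R + 1) = - (a + k%:R)); last by ring.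
  rewrite (_ : a - 1 + k%:R = a + k%:R - 1); last by ring.
  rewrite (_ : a - 1 + (k%:R + 1) = 1 + (a + k%:R - 1)); last by ring.
  rewrite (@powRD _ c 1) ?(gt_eqF c0) ?implybT// (@powRD _ s 1) ?(gt_eqF s0) ?implybT//.
  rewrite !powRr1 ?ltW//; field; rewrite gt_eqF// addr_gt0//.
have addV k s : 0 < s -> V k s + V k.+1 s = c `^ (1 + k%:R - a) * s `^ (- (1 + k%:R - a) - 1).
  move=> s0; rewrite /V -natr1.
  rewrite (_ : 1 - a + k%:R = 1 + k%:R - a); last by ring.
  rewrite (_ : 1 - a + (k%:R + 1) = 1 + (1 + k%:R - a)); last by ring.
  rewrite (_ : a - 1 - k%:R = 1 + (- (1 + k%:R - a) - 1)); last by ring.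
  rewrite (_ : a - 1 - (k%:R + 1) = - (1 + k%:R - a) - 1); last by ring.
  rewrite (@powRD _ c 1) ?(gt_eqF c0) ?implybT// (@powRD _ s 1) ?(gt_eqF s0) ?implybT//.
  rewrite !powRr1 ?ltW//; field; rewrite gt_eqF// addr_gt0//.
have [k|u hu] := @ge0_integral_recursion _ _ R lebesgue_measure _ U
    (fun k => (k%:R + a)^-1) (measurable_itv `]0, c]) (mU _) U0.
  have ka : 0 < a + k%:R by rewrite ltr_wpDr.
  transitivity (\int[lebesgue_measure]_(s in `]0%R, c])
      ((c `^ (- (a + k%:R)))%:E * (s `^ (a + k%:R - 1))%:E))%E.
    apply: eq_integral => s; rewrite inE/= in_itv/= => /andP[s0 _].
    by rewrite addU// EFinM.
  rewrite ge0_integralZl//.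
  - rewrite integral_powR_itvoc// -EFinM powRN; congr EFin.
    by rewrite [k%:R + a]addrC; field; rewrite !gt_eqF ?powR_gt0.
  - by apply/measurable_EFinP/measurable_funTS; exact: measurable_powR.
  - by move=> s _; rewrite lee_fin powR_ge0.
  - by rewrite lee_fin powR_ge0.
have [k|v hv] := @ge0_integral_recursion _ _ R lebesgue_measure _ V
    (fun k => (k%:R + 1 - a)^-1) (measurable_itv `[c, +oo[) (mV _) V0.
  have ka : 0 < 1 + k%:R - a by rewrite addrAC ltr_wpDr// subr_gt0.
  transitivity (\int[lebesgue_measure]_(s in `[c, +oo[)
      ((c `^ (1 + k%:R - a))%:E * (s `^ (- (1 + k%:R - a) - 1))%:E))%E.
    apply: eq_integral => s; rewrite inE/= in_itv/= andbT => s0.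
    by rewrite addV ?EFinM// (lt_le_trans c0).
  rewrite ge0_integralZl//.
  - rewrite integral_powR_itvcy// -EFinM powRN; congr EFin.
    by rewrite [k%:R + 1]addrC; field; rewrite !gt_eqF ?powR_gt0.
  - by apply/measurable_EFinP/measurable_funTS; exact: measurable_powR.
  - by move=> s _; rewrite lee_fin powR_ge0.
  - by rewrite lee_fin powR_ge0.
have w0 : u 0%N + v 0%N = pi / sin (pi * a).
  rewrite -(@csc_recursion _ a (fun k => u k + v k))// => k.
    by have [? _ _] := hu k; have [? _ _] := hv k; rewrite addr_ge0.
  by have [_ _ <-] := hu k; have [_ _ <-] := hv k; rewrite addrACA.
have split0y : `]0, +oo[%classic = `]0, c] `|` `]c, +oo[ :> set R.
  by rewrite -itv_bndbnd_setU// bnd_simp ltW.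
(* At [k = 0] the functions [U] and [V] coincide, so the integrals below and above [c] glue
   together. *)
have UE : (\int[lebesgue_measure]_(s in `]0%R, +oo[) (U 0%N s)%:E = (u 0%N + v 0%N)%:E)%E.
  rewrite split0y ge0_integral_setU//.
  - rewrite EFinD; congr (_ + _)%E; first by have [] := hu 0%N.
    have [_ <- _] := hv 0%N; rewrite -integral_itv_obnd_cbnd.
      by apply: eq_integral => s _; rewrite /U /V !subr0 !addr0.
    exact/measurable_EFinP.
  - by apply/measurable_EFinP; exact: mU.
  - rewrite -split0y => s; rewrite /= in_itv/= andbT => s0.
    by rewrite lee_fin /U !mulr_ge0 ?powR_ge0 ?invr_ge0 ?addr_ge0 ?ltW.
  - rewrite disj_set2E; apply/eqP/seteqP; split => // s [] /=.
    by rewrite !in_itv/= andbT leNgt => /andP[_ /negbTE ->].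
rewrite -w0 EFinM -UE -ge0_integralZl//.
- apply: eq_integral => s _; rewrite -EFinM /U; congr EFin.
  rewrite subr0 addr0 !mulrA -powRD; last by rewrite (gt_eqF c0) implybT.
  by rewrite (_ : a - 1 + (1 - a) = 0) ?powRr0 ?mul1r//; ring.
- by apply/measurable_EFinP; exact: mU.
- move=> s; rewrite /= in_itv/= andbT => s0.
  by rewrite lee_fin /U !mulr_ge0 ?powR_ge0 ?invr_ge0 ?addr_ge0 ?ltW.
- by rewrite lee_fin powR_ge0.
Qed.

(** * Laws with an atom at 0 *)

Lemma expectationE d (T : measurableType d) (R : realType) (P : probability T R)
  (g : T -> R) : ('E_P[g] = \int[P]_x (g x)%:E)%E.
Proof. by rewrite unlock. Qed.

Lemma ae_integral_restrict d (T : measurableType d) (R : realType)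
    (m : {measure set T -> \bar R}) (D : set T) (g : T -> \bar R) :
  measurable D -> m (~` D) = 0%E -> measurable_fun [set: T] g ->
  (\int[m]_x g x = \int[m]_(x in D) g x)%E.
Proof.
move=> mD mD0 mg; rewrite [RHS]integral_mkcond; apply: ae_eq_integral => //.
  by apply/(measurable_restrictT _ mD); exact: measurable_funTS.
exists (~` D); split => //; first exact: measurableC.
move=> x /= h Dx; apply: h => _; rewrite patchE mem_set//.
Qed.

Lemma compactly_supported_on_nonneg_lt0 (R : realType)
    (mu : probability (measurableTypeR R) R) :
  compactly_supported_on_nonneg mu -> mu (~` `[0, +oo[) = 0%E.
Proof.
move=> [K [cK K0 muK]].
have mK : measurable (K : set (measurableTypeR R)) by exact: compact_measurable.
apply/eqP; rewrite eq_le measure_ge0 andbT.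
rewrite (@le_trans _ _ (mu (~` K)))//.
  apply: le_measure; rewrite ?inE; [|exact: measurableC|exact: subsetC].
  by apply: measurableC; exact: measurable_itv.
by rewrite probability_setC// muK subee.
Qed.

(** [q] is the mass off 0 and [nu] the normalised restriction of [mu] to the complement of 0. A null
    mass off 0 would make the mean vanish. *)
Lemma zero_atom_decomposition_exists (R : realType)
    (mu : probability (measurableTypeR R) R) :
  mu (~` `[0, +oo[) = 0%E -> (0 < 'E_mu[fun s : R => s])%E ->
  exists q nu, zero_atom_decomposition mu q nu.
Proof.
move=> mu0 mean0.
pose p : R := fine (mu [set 0]).
have pE : mu [set 0] = p%:E by rewrite fineK// fin_num_measure.
have mC : measurable (~` [set 0] : set (measurableTypeR R)) by exact: measurableC.
have qE : mu (~` [set 0]) = (1 - p)%:E by rewrite probability_setC// pE.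
have q0 : 0 < 1 - p.
  rewrite -lte_fin -qE lt_neqAle measure_ge0 andbT eq_sym; apply/eqP => mu00.
  move: mean0; rewrite expectationE.
  rewrite (@ae_integral_restrict _ _ _ mu ([set 0] : set (measurableTypeR R)))//.
    by rewrite (integral0_eq _) ?ltxx// => x /= ->.
(* The second argument [mu] is the fallback value of [mnormalize] for a measure of zero or infinite
   mass, a case excluded by [q0]. *)
exists (1 - p), (mnormalize (mrestr mu mC) mu); split => //.
- by rewrite gerBl fine_ge0.
- rewrite /= /mnormalize /= /mrestr.
  rewrite setTI qE ifF.
    by rewrite setICr measure0 mul0e.
  by rewrite orbF; apply: gt_eqF; rewrite lte_fin.
- move=> A mA; rewrite /= /mnormalize /= /mrestr.
  rewrite setTI qE ifF; last first.
    by rewrite orbF; apply: gt_eqF; rewrite lte_fin.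
  rewrite /= muleCA -(EFinM (1 - p)) mulfV ?gt_eqF// mule1 subKr.
  rewrite [LHS](@measureDI _ _ _ mu A [set 0])// setDE addeC; congr (_ + _)%E.
  rewrite diracE; have [A0|A0] := pselect (A 0).
    by rewrite mem_set// mule1 -pE; congr (mu _); apply/setIidPr => x ->.
  rewrite memNset// mule0 -[RHS](measure0 mu); congr (mu _).
  by apply/seteqP; split => // x [Ax x0]; apply: A0; rewrite -x0.
Qed.

(** Additivity of nonnegative integrals in the measure. The integral against [nu] is kept on the
    open half-line, where later identities may divide by [s]. *)
Lemma integral_zero_atom_decomposition (R : realType)
    (mu nu : probability (measurableTypeR R) R) (q : R) (g : R -> R) :
  mu (~` `[0, +oo[) = 0%E -> zero_atom_decomposition mu q nu ->
  measurable_fun [set: R] g -> (forall s, 0 <= s -> 0 <= g s) ->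
  (\int[mu]_s (g s)%:E =
   (1 - q)%:E * (g 0)%:E + q%:E * \int[nu]_(s in `]0%R, +oo[) (g s)%:E)%E.
Proof.
move=> mu0 [q0 q1 nu0 muE] mg g0.
have q'0 : 0 <= 1 - q by rewrite subr_ge0.
pose m1 := mscale (NngNum q'0) (\d_(0 : measurableTypeR R)).
pose m2 := mscale (NngNum (ltW q0)) nu.
have mD : measurable (`[0, +oo[ : set (measurableTypeR R)) by exact: measurable_itv.
have mDg A : measurable_fun (A : set (measurableTypeR R)) (EFin \o g).
  by apply/measurable_EFinP; exact: measurable_funTS.
have g0E s : `[0, +oo[%classic s -> (0 <= (g s)%:E)%E.
  by rewrite /= in_itv/= andbT lee_fin => /g0.
rewrite (ae_integral_restrict mD mu0)//.
rewrite (eq_measure_integral (measure_add m1 m2)); last first.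
  move=> A mA _; exact: etrans (muE A mA) (esym (measure_addE m1 m2 A)).
rewrite ge0_integral_measure_add// !ge0_integral_mscale//=.
congr (_ + _ * _)%E.
  by rewrite integral_dirac// diracE mem_set/= ?mul1e// in_itv/= lexx.
have split0 : `[0, +oo[%classic = [set 0] `|` `]0, +oo[ :> set R.
  by rewrite setU1itv.
rewrite split0 ge0_integral_setU//.
- rewrite (@ge0_negligible_integral _ _ _ nu _ ([set 0] : set (measurableTypeR R)))//.
    by rewrite setDv integral_set0 add0e.
  by move=> x ->; rewrite lee_fin g0.
- by move=> s; rewrite -split0 => /g0E.
- rewrite disj_set2E; apply/eqP/seteqP; split => // s [] /= ->.
  by rewrite in_itv/= ltxx.
Qed.

Lemma zero_atom_decomposition_pos (R : realType)
    (mu nu : probability (measurableTypeR R) R) (q : R) :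
  mu (~` `[0, +oo[) = 0%E -> zero_atom_decomposition mu q nu ->
  nu (~` `]0, +oo[) = 0%E.
Proof.
move=> mu0 [q0 q1 nu0 muE].
have mC : measurable (~` `[0, +oo[ : set (measurableTypeR R)).
  by apply: measurableC; exact: measurable_itv.
have nuC : nu (~` `[0, +oo[) = 0%E.
  apply/eqP; have /eqP := etrans (esym (muE _ mC)) mu0.
  rewrite padde_eq0.
  - by move=> /andP[_]; rewrite mule_eq0 eqe gt_eqF.
  - by rewrite mule_ge0// lee_fin subr_ge0.
  - by rewrite mule_ge0// lee_fin ltW.
rewrite (_ : ~` _ = ~` `[0, +oo[ `|` [set 0]) ?measureU0//.
apply/seteqP; split => x /=; rewrite !in_itv/= !andbT.
  move=> /negP; rewrite -leNgt => x0; have [/eqP ->|xN0] := boolP (x == 0).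
    by right.
  by left; apply/negP; rewrite -ltNge lt_neqAle xN0.
move=> [/negP|->]; last by rewrite ltxx.
by rewrite -ltNge => x0; apply/negP; rewrite -leNgt ltW.
Qed.

Lemma expectation_pos (R : realType) (nu : probability (measurableTypeR R) R)
    (g : R -> R) : nu (~` `]0, +oo[) = 0%E -> measurable_fun [set: R] g ->
  ('E_nu[g] = \int[nu]_(s in `]0%R, +oo[) (g s)%:E)%E.
Proof.
move=> nu0 mg; rewrite expectationE.
rewrite (@ae_integral_restrict _ _ _ nu (`]0, +oo[ : set (measurableTypeR R)))//.
exact/measurable_EFinP.
Qed.

Lemma integral_pos_cst (R : realType) (nu : probability (measurableTypeR R) R) (r : R) :
  nu (~` `]0, +oo[) = 0%E -> (\int[nu]_(s in `]0%R, +oo[) r%:E = r%:E)%E.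
Proof.
move=> nu0; rewrite integral_cst; last exact: measurable_itv.
have mD : measurable (`]0, +oo[ : set (measurableTypeR R)) by exact: measurable_itv.
have : nu `]0, +oo[%classic = 1%E.
  by rewrite -[in LHS](setCK `]0, +oo[%classic) probability_setC ?nu0 ?sube0//; exact: measurableC.
by move=> nu1; rewrite -[RHS]mule1; congr (_ * _)%E; exact: nu1.
Qed.

(** The bound [1 / (s + c) <= 1 / c] makes the integral finite, so [fine] loses nothing in [G]. *)
Lemma integral_GE (R : realType) (nu : probability (measurableTypeR R) R) (c : R) :
  nu (~` `]0, +oo[) = 0%E -> 0 < c ->
  (\int[nu]_(s in `]0%R, +oo[) ((s + c)^-1)%:E = (G nu c)%:E)%E.
Proof.
move=> nu0 c0; rewrite /G expectation_pos//; last exact: measurable_fun_invDr.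
rewrite fineK// ge0_fin_numE; last first.
  apply: integral_ge0 => s; rewrite /= in_itv/= andbT => s0.
  by rewrite lee_fin invr_ge0 addr_ge0 ?ltW.
apply: (@le_lt_trans _ _ (\int[nu]_(s in `]0%R, +oo[) (c^-1)%:E)%E).
  apply: ge0_le_integral => //.
  - move=> s; rewrite /= in_itv/= andbT => s0.
    by rewrite lee_fin invr_ge0 addr_ge0 ?ltW.
  - by apply/measurable_EFinP/measurable_funTS; exact: measurable_fun_invDr.
  - move=> s; rewrite /= in_itv/= andbT => s0.
    by rewrite lee_fin lef_pV2 ?posrE ?addr_gt0// lerDr ltW.
by rewrite integral_pos_cst// ltry.
Qed.

(** Integrate [s / (s + c) + c / (s + c) = 1] and cancel the finite second term. *)
Lemma integral_one_subG (R : realType) (nu : probability (measurableTypeR R) R) (c : R) :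
  nu (~` `]0, +oo[) = 0%E -> 0 < c ->
  (\int[nu]_(s in `]0%R, +oo[) (s / (s + c))%:E = (1 - c * G nu c)%:E)%E.
Proof.
move=> nu0 c0.
have m1 : measurable_fun [set: R] (fun s : R => s / (s + c)).
  by apply: measurable_funM => //; exact: measurable_fun_invDr.
have mD (f : R -> R) : measurable_fun [set: R] f ->
    measurable_fun (`]0, +oo[ : set (measurableTypeR R)) (EFin \o f).
  by move=> mf; apply/measurable_EFinP/measurable_funTS.
have : (\int[nu]_(s in `]0%R, +oo[) (s / (s + c))%:E + c%:E * (G nu c)%:E = 1%:E)%E.
  rewrite -integral_GE// -ge0_integralZl//.
  - rewrite -ge0_integralD//.
    + rewrite -[RHS](integral_pos_cst 1 nu0); apply: eq_integral => s.
      rewrite inE/= in_itv/= andbT => s0; rewrite -EFinM -EFinD; congr EFin.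
      by field; rewrite gt_eqF// addr_gt0.
    + move=> s; rewrite /= in_itv/= andbT => s0.
      by rewrite lee_fin divr_ge0 ?addr_ge0 ?ltW.
    + exact: mD.
    + move=> s; rewrite /= in_itv/= andbT => s0.
      by rewrite lee_fin mulr_ge0 ?invr_ge0 ?addr_ge0 ?ltW.
    + apply: mD; apply: measurable_funM => //; exact: measurable_fun_invDr.
  - by apply: mD; exact: measurable_fun_invDr.
  - move=> s; rewrite /= in_itv/= andbT => s0.
    by rewrite lee_fin invr_ge0 addr_ge0 ?ltW.
  - by rewrite lee_fin ltW.
rewrite -EFinM EFinB => <-; rewrite addeK//.
Qed.

(** Dividing by [w], the two integrands become [sigma2 / (s + c)] and [s / (s + c)] with
    [c = sigma2 / w]; their values at the atom are [w] and 0. *)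
Lemma L_zero_atom (R : realType) (sigma2 : R)
    (mu nu : probability (measurableTypeR R) R) (q w : R) :
  0 < sigma2 -> mu (~` `[0, +oo[) = 0%E -> zero_atom_decomposition mu q nu ->
  0 < w ->
  L sigma2 mu w = ((1 - q) * w + q * sigma2 * G nu (sigma2 / w)) /
                  (q * (1 - sigma2 / w * G nu (sigma2 / w))).
Proof.
move=> s20 mu0 dec w0; have nu0 := zero_atom_decomposition_pos mu0 dec.
have c0 : 0 < sigma2 / w by rewrite divr_gt0.
have den0 s : 0 <= s -> 0 < sigma2 + w * s.
  by move=> s0; rewrite ltr_wpDr// mulr_ge0 ?(ltW w0).
have mden : measurable_fun [set: R] (fun s : R => (sigma2 + w * s)^-1).
  apply: (measurableT_comp (@measurable_fun_invr R)).
  by apply: measurable_funD => //; exact: measurable_funM.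
have num : (\int[nu]_(s in `]0%R, +oo[) (sigma2 * w / (sigma2 + w * s))%:E =
    (sigma2 * G nu (sigma2 / w))%:E)%E.
  rewrite EFinM -integral_GE// -ge0_integralZl//.
  - apply: eq_integral => s; rewrite inE/= in_itv/= andbT => s0.
    rewrite -EFinM; congr EFin; field.
    have := den0 _ (ltW s0); rewrite addrC mulrC => ?; rewrite !gt_eqF//.
  - by apply/measurable_EFinP/measurable_funTS; exact: measurable_fun_invDr.
  - move=> s; rewrite /= in_itv/= andbT => s0.
    by rewrite lee_fin invr_ge0 addr_ge0 ?ltW.
  - by rewrite lee_fin ltW.
have den : (\int[nu]_(s in `]0%R, +oo[) (w * s / (sigma2 + w * s))%:E =
    (1 - sigma2 / w * G nu (sigma2 / w))%:E)%E.
  rewrite -integral_one_subG//.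
  apply: eq_integral => s; rewrite inE/= in_itv/= andbT => s0.
  congr EFin; field.
  have := den0 _ (ltW s0); rewrite addrC mulrC => ?; rewrite !gt_eqF//.
rewrite /L !expectationE !(integral_zero_atom_decomposition mu0 dec).
- rewrite num den mulr0 addr0 mul0r mule0 add0e -!EFinM -EFinD/=.
  by rewrite [sigma2 * w]mulrC mulfK ?gt_eqF// mulrA.
- by apply: measurable_funM => //; exact: measurable_funM.
- by move=> s s0; rewrite divr_ge0 ?mulr_ge0 ?(ltW (den0 _ s0)) ?(ltW w0).
- exact: measurable_funM.
- by move=> s s0; rewrite divr_ge0 ?mulr_ge0 ?(ltW (den0 _ s0)) ?(ltW w0) ?ltW.
Qed.

(** * Limits of the Stieltjes transform at 0 *)

(** Dominated convergence is a statement on sequences; it transfers to a continuous parameter by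
    testing along every positive sequence tending to 0. *)
Lemma cvg_integral_at_right0 (R : realType) (nu : probability (measurableTypeR R) R)
    (h : R -> R -> R) (h0 g : R -> R) (H : R -> R) (l : R) :
  (forall c, measurable_fun [set: R] (h c)) -> measurable_fun [set: R] h0 ->
  (forall s, 0 < s -> h c s @[c --> 0^'+] --> h0 s) ->
  nu.-integrable `]0, +oo[ (EFin \o g) ->
  (forall c s, 0 < c -> 0 < s -> `|h c s| <= g s) ->
  (forall c, 0 < c -> (\int[nu]_(s in `]0%R, +oo[) (h c s)%:E = (H c)%:E)%E) ->
  (\int[nu]_(s in `]0%R, +oo[) (h0 s)%:E = l%:E)%E ->
  H c @[c --> 0^'+] --> l.
Proof.
move=> mh mh0 hh0 ig hg hH h0l; apply/cvg_at_rightP => u [u0 ucvg].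
have mD (f : R -> R) : measurable_fun [set: R] f ->
    measurable_fun (`]0, +oo[ : set (measurableTypeR R)) (EFin \o f).
  by move=> mf; apply/measurable_EFinP/measurable_funTS.
have [||||||_ _] := @dominated_convergence _ _ R nu `]0, +oo[ _
  (fun n s => (h (u n) s)%:E) (EFin \o h0) (EFin \o g).
- exact: measurable_itv.
- by move=> n; exact: mD.
- exact: mD.
- apply: aeW => s; rewrite /= in_itv/= andbT => s0.
  apply: cvg_EFin; first exact: nearW.
  by move/cvg_at_rightP : (hh0 _ s0); apply.
- exact: ig.
- apply: aeW => s n; rewrite /= in_itv/= andbT => s0.
  by rewrite lee_fin hg.
rewrite h0l; under eq_fun do rewrite hH//.
by move/fine_cvg; apply.
Qed.

Lemma cvg_invD_at_right0 (R : realType) (s : R) : 0 < s ->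
  (s + c)^-1 @[c --> 0^'+] --> s^-1.
Proof.
move=> s0; suff : s + c @[c --> 0^'+] --> s by apply: cvgV; rewrite gt_eqF.
by rewrite -[X in _ --> X]addr0; apply: cvgD; [exact: cvg_cst|apply: cvg_at_right_filter; exact: cvg_id].
Qed.

Lemma one_subG_cvg (R : realType) (nu : probability (measurableTypeR R) R) :
  nu (~` `]0, +oo[) = 0%E -> 1 - c * G nu c @[c --> 0^'+] --> (1 : R).
Proof.
move=> nu0; have mD : measurable (`]0, +oo[ : set (measurableTypeR R)) by exact: measurable_itv.
apply: (@cvg_integral_at_right0 _ nu (fun c s => s / (s + c)) (cst 1) (cst 1)).
- by move=> c; apply: measurable_funM => //; exact: measurable_fun_invDr.
- exact: measurable_cst.
- move=> s s0; rewrite /cst/= -(@mulfV _ s) ?gt_eqF//.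
  by apply: cvgMl_tmp; exact: cvg_invD_at_right0.
- exact: finite_measure_integrable_cst.
- move=> c s c0 s0; rewrite ger0_norm ?divr_ge0 ?addr_ge0 ?(ltW s0) ?(ltW c0)//.
  by rewrite ler_pdivrMr ?addr_gt0// mul1r lerDl ltW.
- by move=> c c0; exact: integral_one_subG.
- exact: integral_pos_cst.
Qed.

Lemma G_cvg (R : realType) (nu : probability (measurableTypeR R) R) :
  nu (~` `]0, +oo[) = 0%E -> ('E_nu[fun s : R => (s^-1)%R] < +oo)%E ->
  G nu c @[c --> 0^'+] --> fine 'E_nu[fun s : R => (s^-1)%R].
Proof.
move=> nu0; have mD : measurable (`]0, +oo[ : set (measurableTypeR R)) by exact: measurable_itv.
rewrite expectation_pos//; last exact: measurable_fun_invr.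
have inv0 s : (`]0, +oo[%classic : set R) s -> (0 <= (s^-1)%:E)%E.
  by rewrite /= in_itv/= andbT => s0; rewrite lee_fin invr_ge0 ltW.
move=> fin; apply: (@cvg_integral_at_right0 _ nu (fun c s => (s + c)^-1)
  (@GRing.inv R) (@GRing.inv R)).
- by move=> c; exact: measurable_fun_invDr.
- exact: measurable_fun_invr.
- exact: cvg_invD_at_right0.
- apply/integrableP; split.
    by apply/measurable_EFinP/measurable_funTS; exact: measurable_fun_invr.
  apply: le_lt_trans fin; rewrite le_eqVlt; apply/orP; left; apply/eqP.
  by apply: eq_integral => s /set_mem/inv0 s0; rewrite gee0_abs.
- move=> c s c0 s0; rewrite ger0_norm ?invr_ge0 ?addr_ge0 ?(ltW s0) ?(ltW c0)//.
  by rewrite lef_pV2 ?posrE ?addr_gt0// lerDl ltW.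
- by move=> c c0; exact: integral_GE.
- by rewrite fineK// ge0_fin_numE//; apply: integral_ge0.
Qed.

Lemma cvg_div_at_right0 (R : realType) (r : R) : 0 < r -> r / w @[w --> +oo] --> 0^'+.
Proof.
move=> r0 A /= [e /= e0 eA]; exists (r / e); split; first exact: num_real.
move=> w rw; have w0 : 0 < w by apply: lt_trans rw; rewrite divr_gt0.
apply: eA; last by rewrite divr_gt0.
by rewrite /= sub0r normrN gtr0_norm ?divr_gt0// ltr_pdivrMr// mulrC -ltr_pdivrMr.
Qed.

Lemma near_pinfty_gt0 (R : realType) (P : R -> Prop) :
  (forall w, 0 < w -> P w) -> \forall w \near +oo, P w.
Proof. by move=> hP; exists 0; split => // w; exact: hP. Qed.

Lemma L_equiv_atom (R : realType) (sigma2 : R)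
    (mu nu : probability (measurableTypeR R) R) (q : R) :
  0 < sigma2 -> mu (~` `[0, +oo[) = 0%E -> zero_atom_decomposition mu q nu ->
  q < 1 -> equiv_at_infty (L sigma2 mu) (fun w => (1 - q) / q * w).
Proof.
move=> s20 mu0 dec q1; have nu0 := zero_atom_decomposition_pos mu0 dec.
have [q0 _ _ _] := dec.
(* The quotient of [L] by its claimed equivalent is a function of [x = 1 - c * G nu c] alone,
   continuous at the limit 1 of [x], where its value is 1. *)
pose f (x : R) := (1 + q / (1 - q) * (1 - x)) / x.
rewrite /equiv_at_infty.
have : f (1 - c * G nu c) @[c --> 0^'+] --> f 1.
  apply: (cvg_comp _ _ (one_subG_cvg nu0)).
  apply: cvgM; last by apply: cvgV => //; exact: cvg_id.
  apply: cvgD; first exact: cvg_cst.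
  by apply: cvgMl_tmp; apply: cvgB; [exact: cvg_cst|exact: cvg_id].
rewrite {2}/f subrr mulr0 addr0 divr1.
move/(cvg_comp _ _ (cvg_div_at_right0 s20)); apply: cvg_trans; apply: near_eq_cvg.
apply: near_pinfty_gt0 => w w0; rewrite (L_zero_atom s20 mu0 dec w0) /= /f.
have q'0 : 1 - q != 0 by rewrite subr_eq0 gt_eqF.
have -> : 1 - (1 - sigma2 / w * G nu (sigma2 / w)) = sigma2 / w * G nu (sigma2 / w).
  by rewrite subKr.
(* If [x = 0], both sides are 0 by the convention on division by 0. *)
set x := 1 - sigma2 / w * _; have [->|x0] := eqVneq x 0.
  by rewrite mulr0 invr0 !(mulr0, mul0r).
by field; rewrite x0 q'0 !gt_eqF.
Qed.

Lemma zero_atom_decomposition_refl (R : realType)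
    (mu : probability (measurableTypeR R) R) : mu [set 0] = 0%E ->
  zero_atom_decomposition mu 1 mu.
Proof.
move=> mu0; split => // A mA.
by rewrite subrr mul0e add0e mul1e.
Qed.

(** For [q = 1] the denominator [1 - c * G mu c] tends to 1, so [L] inherits any asymptotics of
    [sigma2 * G]. A constant [X] serves (ii), a divergent one (iii). *)
Lemma L_ratio_cvg (R : realType) (sigma2 : R)
    (mu : probability (measurableTypeR R) R) (X : R -> R) (l : R) :
  0 < sigma2 -> mu (~` `[0, +oo[) = 0%E -> mu [set 0] = 0%E ->
  G mu c / X c @[c --> 0^'+] --> l ->
  L sigma2 mu w / X (sigma2 / w) @[w --> +oo] --> sigma2 * l.
Proof.
move=> s20 mu0 mu00 GX; have dec := zero_atom_decomposition_refl mu00.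
have mu0' := zero_atom_decomposition_pos mu0 dec.
have : sigma2 * (G mu c / X c) / (1 - c * G mu c) @[c --> 0^'+] --> sigma2 * l / 1.
  apply: cvgM; first exact: cvgMl_tmp.
  by apply: cvgV => //; exact: one_subG_cvg.
rewrite divr1 => /(cvg_comp _ _ (cvg_div_at_right0 s20)); apply: cvg_trans; apply: near_eq_cvg.
apply: near_pinfty_gt0 => w w0; rewrite (L_zero_atom s20 mu0 dec w0)/=.
by rewrite subrr mul0r add0r !mul1r -!mulrA; congr (_ * (_ * _)); rewrite mulrC.
Qed.

Lemma L_cvg (R : realType) (sigma2 : R) (mu : probability (measurableTypeR R) R) :
  0 < sigma2 -> mu (~` `[0, +oo[) = 0%E -> mu [set 0] = 0%E ->
  ('E_mu[fun s : R => (s^-1)%R] < +oo)%E ->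
  L sigma2 mu w @[w --> +oo] --> sigma2 * fine 'E_mu[fun s : R => (s^-1)%R].
Proof.
move=> s20 mu0 mu00 fin.
have mu0' := zero_atom_decomposition_pos mu0 (zero_atom_decomposition_refl mu00).
have G1 : G mu c / 1 @[c --> 0^'+] --> fine 'E_mu[fun s : R => (s^-1)%R].
  by under eq_fun do rewrite divr1; exact: G_cvg.
have := L_ratio_cvg (X := fun=> 1) s20 mu0 mu00 G1.
by under eq_fun do rewrite divr1.
Qed.

(** * Regularly varying densities *)

(** A density forces absolute continuity and agrees almost everywhere with the Radon-Nikodym
    derivative, whose change of variables formula then applies. Absolute values make [g] nonnegative
    outside [D] too. *)
Lemma integral_has_density (R : realType) (mu : probability (measurableTypeR R) R)
    (f g : R -> R) (D : set (measurableTypeR R)) :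
  has_density mu f -> measurable D -> measurable_fun [set: R] g ->
  (forall s, D s -> 0 <= g s) ->
  (\int[mu]_(s in D) (g s)%:E = \int[lebesgue_measure]_(s in D) (g s * f s)%:E)%E.
Proof.
move=> [mf f0 muE] mD mg g0.
pose la : {sigma_finite_measure set (measurableTypeR R) -> \bar R} := @lebesgue_measure R.
have dom : mu `<< la.
  apply/null_content_dominatesP => A mA A0.
  rewrite muE// null_set_integral//; last exact/measurable_EFinP/measurable_funTS.
transitivity (\int[mu]_(s in D) `|(g s)%:E|)%E.
  by apply: eq_integral => s /set_mem/g0 gs; rewrite gee0_abs.
have mabs : measurable_fun D (fun s => `|(g s)%:E|%E).
  by apply: measurableT_comp => //; exact/measurable_EFinP/measurable_funTS.
rewrite -(Radon_Nikodym_SigmaFinite.change_of_variables dom)//.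
have mRN : measurable_fun [set: R] (Radon_Nikodym_SigmaFinite.f mu la).
  exact: measurable_int (Radon_Nikodym_SigmaFinite.f_integrable dom).
have mfD : measurable_fun D (EFin \o f) by exact/measurable_EFinP/measurable_funTS.
apply: (etrans (@ae_eq_integral _ _ R la D
  (fun s => `|(g s)%:E| * (f s)%:E)%E _ _ _ _ _)) => //.
- by apply: emeasurable_funM => //; exact: measurable_funTS.
- exact: emeasurable_funM.
- apply: ae_eqe_mul2l; apply: integral_ae_eq => //.
    apply: integrableS (Radon_Nikodym_SigmaFinite.f_integrable dom) => //.
  move=> E ED mE.
  exact: etrans (esym (Radon_Nikodym_SigmaFinite.f_integral dom mE)) (muE E mE).
- by apply: eq_integral => s /set_mem/g0 gs; rewrite gee0_abs.
Qed.

(** Beyond [d] the integrand is at most [1 / d] and the law has mass at most 1, which bounds the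
    remainder [t] uniformly in [c]. The case [c = 0] is included for the finiteness of the inverse
    moment. *)
Lemma integral_inv_split (R : realType) (mu : probability (measurableTypeR R) R)
    (f : R -> R) (c d : R) : has_density mu f -> 0 <= c -> 0 < d ->
  exists t : R, 0 <= t <= d^-1 /\
  (\int[mu]_(s in `]0%R, +oo[) ((s + c)^-1)%:E =
   \int[lebesgue_measure]_(s in `]0%R, d[) ((s + c)^-1 * f s)%:E + t%:E)%E.
Proof.
move=> dens c0 d0.
pose A : set (measurableTypeR R) := `]0, d[%classic.
pose B : set (measurableTypeR R) := `[d, +oo[%classic.
have mA : measurable A by exact: measurable_itv.
have mB : measurable B by exact: measurable_itv.
have inv0 s : 0 < s -> 0 <= (s + c)^-1.
  by move=> s0; rewrite invr_ge0 addr_ge0// ltW.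
have minv (D : set (measurableTypeR R)) : measurable_fun D (fun s => ((s + c)^-1)%:E).
  by apply/measurable_EFinP/measurable_funTS; exact: measurable_fun_invDr.
have Bd s : B s -> ((s + c)^-1 <= d^-1).
  rewrite /B/= in_itv/= andbT => ds.
  by rewrite lef_pV2 ?posrE// ?ltr_wpDr ?(lt_le_trans d0)// (le_trans ds)// lerDl.
have B0 s : B s -> 0 <= (s + c)^-1.
  by rewrite /B/= in_itv/= andbT => ds; rewrite inv0// (lt_le_trans d0).
pose T := (\int[mu]_(s in B) ((s + c)^-1)%:E)%E.
have T0 : (0 <= T)%E by apply: integral_ge0 => s /B0; rewrite lee_fin.
have Td : (T <= d^-1%:E)%E.
  apply: (@le_trans _ _ (\int[mu]_(s in B) (d^-1)%:E)%E).
    exact: ge0_le_integral.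
  rewrite integral_cst// -[leRHS]mule1 lee_pmul2l//; last by rewrite lte_fin invr_gt0.
  exact: probability_le1.
have Tfin : T \is a fin_num by rewrite ge0_fin_numE// (le_lt_trans Td)// ltry.
exists (fine T); rewrite fine_ge0//= -lee_fin fineK//; split => //.
rewrite -(integral_has_density dens mA).
- rewrite -ge0_integral_setU//.
  + by rewrite /A /B -itv_bndbnd_setU ?bnd_simp.
  + move=> s [|/B0//]; rewrite /A/= in_itv/= => /andP[s0 _].
    by rewrite lee_fin inv0.
  + rewrite disj_set2E; apply/eqP/seteqP; split => // s []; rewrite /A /B/= !in_itv/= andbT.
    by move=> /andP[_ /lt_le_trans sd] /sd; rewrite ltxx.
- exact: measurable_fun_invDr.
- by move=> s; rewrite /A/= in_itv/= => /andP[s0 _]; exact: inv0.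
Qed.

Lemma integral_density_le (R : realType) (f phi : R -> R) (c d k j : R) :
  measurable_fun [set: R] f -> measurable_fun [set: R] phi ->
  (forall s, 0 <= f s) -> (forall s, 0 <= phi s) -> 0 <= c -> 0 <= k ->
  (forall s, 0 < s < d -> f s <= k * phi s) ->
  (\int[lebesgue_measure]_(s in `]0%R, d[) (phi s / (s + c))%:E = j%:E)%E ->
  (\int[lebesgue_measure]_(s in `]0%R, d[) ((s + c)^-1 * f s)%:E <= (k * j)%:E)%E.
Proof.
move=> mf mphi f0 phi0 c0 k0 fphi jE.
pose A : set (measurableTypeR R) := `]0, d[%classic.
have mA : measurable A by exact: measurable_itv.
have inv0 s : A s -> 0 <= (s + c)^-1.
  rewrite /A/= in_itv/= => /andP[s0 _].
  by rewrite invr_ge0 addr_ge0// ltW.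
have minv := @measurable_fun_invDr R c.
have mD (g : R -> R) : measurable_fun [set: R] g -> measurable_fun A (EFin \o g).
  by move=> mg; apply/measurable_EFinP/measurable_funTS.
rewrite EFinM -jE -ge0_integralZl//.
- apply: ge0_le_integral => //.
  + by move=> s As; rewrite lee_fin mulr_ge0// inv0.
  + by apply: mD; exact: measurable_funM.
  + apply: (mD (fun s => k * (phi s / (s + c)))).
    by apply: measurable_funM => //; exact: measurable_funM.
  + move=> s As; rewrite -EFinM lee_fin [leRHS]mulrA [leLHS]mulrC; apply: ler_wpM2r; first exact: inv0.
    by apply: fphi; move: As; rewrite /A/= in_itv.
- by apply: mD; exact: measurable_funM.
- by move=> s As; rewrite lee_fin mulr_ge0// inv0.
Qed.

(** The term [e * j] comes from replacing [f] by [C * phi] on [(0, d)], and [1 / d] from the rest of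
    the law. *)
Lemma G_approx (R : realType) (mu : probability (measurableTypeR R) R)
    (f phi : R -> R) (C e c d j : R) :
  mu (~` `]0, +oo[) = 0%E -> has_density mu f ->
  measurable_fun [set: R] phi -> (forall s, 0 <= phi s) ->
  0 <= C -> 0 <= e -> 0 < c -> 0 < d ->
  (forall s, 0 < s < d -> `|f s - C * phi s| <= e * phi s) ->
  (\int[lebesgue_measure]_(s in `]0%R, d[) (phi s / (s + c))%:E = j%:E)%E ->
  `|G mu c - C * j| <= e * j + d^-1.
Proof.
move=> mu0 dens mphi phi0 C0 e0 c0 d0 fphi jE; have [mf f0 _] := dens.
have [t [/andP[t0 td]]] := integral_inv_split dens (ltW c0) d0.
rewrite integral_GE//.
pose A : set (measurableTypeR R) := `]0, d[%classic.
have mA : measurable A by exact: measurable_itv.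
set I := (\int[_]_(s in _) _)%E => GE.
have inv0 s : A s -> 0 <= (s + c)^-1.
  rewrite /A/= in_itv/= => /andP[s0 _].
  by rewrite invr_ge0 addr_ge0// ltW.
have minv := @measurable_fun_invDr R c.
have mD (g : R -> R) : measurable_fun [set: R] g -> measurable_fun A (EFin \o g).
  by move=> mg; apply/measurable_EFinP/measurable_funTS.
have I0 : (0 <= I)%E.
  by apply: integral_ge0 => s As; rewrite lee_fin mulr_ge0// inv0.
have IC : (I <= ((C + e) * j)%:E)%E.
  apply: (integral_density_le (phi := phi)) => //; [exact: ltW|exact: addr_ge0|].
  by move=> s /fphi; rewrite ler_norml => /andP[_]; rewrite lerBlDl mulrDl.
have Ifin : I \is a fin_num by rewrite ge0_fin_numE// (le_lt_trans IC)// ltry.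
(* The lower bound on [f] is used in the additive form [C * phi <= f + e * phi], so that all
   integrands stay nonnegative. *)
have CI : ((C * j)%:E <= I + (e * j)%:E)%E.
  rewrite !EFinM -jE -!ge0_integralZl//.
  - rewrite -ge0_integralD//.
    + apply: ge0_le_integral => //.
      * by move=> s As; rewrite lee_fin !mulr_ge0// inv0.
      * apply: (mD (fun s => C * (phi s / (s + c)))).
        by apply: measurable_funM => //; exact: measurable_funM.
      * apply: (mD (fun s => (s + c)^-1 * f s + e * (phi s / (s + c)))).
        apply: measurable_funD; first exact: measurable_funM.
        by apply: measurable_funM => //; exact: measurable_funM.
      * move=> s As; rewrite -!EFinM -EFinD lee_fin.
        rewrite !mulrA [_ * f s]mulrC -mulrDl; apply: ler_wpM2r; first exact: inv0.
        have /fphi : 0 < s < d by move: As; rewrite /A/= in_itv.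
        by rewrite ler_norml => /andP[+ _]; lra.
    + by move=> s As; rewrite lee_fin mulr_ge0// inv0.
    + by apply: mD; exact: measurable_funM.
    + by move=> s As; rewrite lee_fin !mulr_ge0// inv0.
    + apply: (mD (fun s => e * (phi s / (s + c)))).
      by apply: measurable_funM => //; exact: measurable_funM.
  - by apply: mD; exact: measurable_funM.
  - by move=> s As; rewrite lee_fin mulr_ge0// inv0.
  - by apply: mD; exact: measurable_funM.
  - by move=> s As; rewrite lee_fin mulr_ge0// inv0.
move: GE IC CI; rewrite -(fineK Ifin) -!EFinD !lee_fin => -[->].
move: (fine I) => i IC CI; rewrite ler_norml; apply/andP; split; lra.
Qed.

Lemma near_at_right0 (R : realType) (P : R -> Prop) :
  (\forall s \near 0^'+, P s) -> exists2 d : R, 0 < d & forall s, 0 < s < d -> P s.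
Proof.
move=> [d /= d0 dP]; exists d => // s /andP[s0 sd].
by apply: dP => //=; rewrite sub0r normrN gtr0_norm.
Qed.

(** [X] stands for the model integral up to a bounded error. Since [X] diverges, the bound [B] may
    depend on the cutoff [d], itself chosen from the precision [e]. *)
Lemma G_ratio_cvg (R : realType) (mu : probability (measurableTypeR R) R)
    (f phi X : R -> R) (C : R) :
  mu (~` `]0, +oo[) = 0%E -> has_density mu f ->
  measurable_fun [set: R] phi -> (forall s, 0 <= phi s) -> 0 <= C ->
  (forall e : R, 0 < e -> \forall s \near 0^'+, `|f s - C * phi s| <= e * phi s) ->
  X c @[c --> 0^'+] --> +oo ->
  (forall d, 0 < d -> exists B, forall c, 0 < c < 1 -> exists2 j,
    (\int[lebesgue_measure]_(s in `]0%R, d[) (phi s / (s + c))%:E = j%:E)%E &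
    `|j - X c| <= B) ->
  G mu c / X c @[c --> 0^'+] --> C.
Proof.
move=> mu0 dens mphi phi0 C0 fphi Xoo hJ; apply/cvgrPdist_le => e e0.
have e20 : 0 < e / 2 by rewrite divr_gt0.
have [d d0 fd] := near_at_right0 (fphi _ e20).
have [B hB] := hJ d d0.
(* [K] collects the errors that stay bounded as [c -> 0]: the distance of [G mu c] to [C * X c] is
   at most [(e / 2) * X c + K], and [K <= (e / 2) * X c] near 0. *)
pose K := (e / 2 + C) * B + d^-1.
have XK : \forall c \near 0^'+, Num.max 1 (K / (e / 2)) <= X c.
  by move/cvgryPge : Xoo; apply.
near=> c.
have c01 : 0 < c < 1.
  by apply/andP; split; near: c; [exact: nbhs_right_gt|exact: nbhs_right_lt].
have : Num.max 1 (K / (e / 2)) <= X c by near: c.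
rewrite ge_max => /andP[X1 XKc].
have X0 : 0 < X c by exact: lt_le_trans X1.
have [j jE jX] := hB c c01; have /andP[c0 c1] := c01.
have := G_approx mu0 dens mphi phi0 C0 (ltW e20) c0 d0 fd jE => hG.
move: XKc; rewrite ler_pdivrMr// /K => XKc.
have -> : C - G mu c / X c = (C * X c - G mu c) / X c by field; rewrite gt_eqF.
rewrite normrM normfV (gtr0_norm X0) ler_pdivrMr// distrC.
have CjX : `|C * j - C * X c| <= C * B by rewrite -mulrBr normrM (ger0_norm C0) ler_wpM2l.
have ejX : e / 2 * j <= e / 2 * X c + e / 2 * B.
  rewrite -mulrDr ler_pM2l// -lerBlDl; exact: le_trans (ler_norm _) jX.
rewrite (_ : G mu c - C * X c = (G mu c - C * j) + (C * j - C * X c)); last by ring.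
apply: (le_trans (ler_normD _ _)); apply: (le_trans (lerD hG CjX)).
lra.
Unshelve. all: by end_near. Qed.

Lemma L_equiv (R : realType) (sigma2 C : R) (mu : probability (measurableTypeR R) R)
    (X Y : R -> R) :
  0 < sigma2 -> 0 < C -> mu (~` `[0, +oo[) = 0%E -> mu [set 0] = 0%E ->
  G mu c / X c @[c --> 0^'+] --> C ->
  (forall w, 0 < w -> Y w = sigma2 * C * X (sigma2 / w)) ->
  equiv_at_infty (L sigma2 mu) Y.
Proof.
move=> s20 C0 mu0 mu00 /(L_ratio_cvg s20 mu0 mu00) LX YE; rewrite /equiv_at_infty.
have sC0 : sigma2 * C != 0 by rewrite gt_eqF// mulr_gt0.
have : (sigma2 * C)^-1 * (L sigma2 mu w / X (sigma2 / w)) @[w --> +oo]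
    --> (sigma2 * C)^-1 * (sigma2 * C) by exact: cvgMl_tmp.
rewrite mulVf//; apply: cvg_trans; apply: near_eq_cvg.
apply: near_pinfty_gt0 => w w0; rewrite YE// [in RHS]invfM.
by rewrite mulrCA.
Qed.

(** * Model integrals for zero, negative and positive exponents *)

Lemma Nln_cvgy (R : realType) : - ln c @[c --> 0^'+] --> (+oo : set_system R).
Proof.
apply/cvgryPge => A; near=> c.
have c0 : 0 < c by near: c; exact: nbhs_right_gt.
rewrite lerNr -ler_expR lnK ?posrE// ltW//.
near: c; apply: nbhs_right_lt; exact: expR_gt0.
Unshelve. all: by end_near. Qed.

Lemma integral_log (R : realType) (c d : R) : 0 < c -> 0 < d ->
  (\int[lebesgue_measure]_(s in `]0%R, d[) (s `^ 0 / (s + c))%:E =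
   (ln (d + c) - ln c)%:E)%E.
Proof.
move=> c0 d0.
have sc0 s : 0 <= s <= d -> 0 < s + c by move=> /andP[s0 _]; rewrite ltr_wpDl.
under eq_integral do rewrite powRr0 mul1r.
have mi : measurable_fun (`]0, d[ : set (measurableTypeR R)) (fun s => ((s + c)^-1)%:E).
  by apply/measurable_EFinP/measurable_funTS; exact: measurable_fun_invDr.
rewrite -(integral_itv_bndoo true false mi).
apply: etrans (integral_segment_derive (F := fun s => ln (s + c)) (ltW d0) _ _) _.
- move=> s /sc0 s0; have dln := is_derive1_ln s0.
  have dg : is_derive s 1 (fun x : R => x + c) (1 + 0) by exact: is_deriveD.
  apply: is_derive_eq (@is_derive1_comp _ _ (fun x : R => x + c) _ _ _ dln dg) _.
  by rewrite addr0 mulr1.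
- move=> s /sc0 s0; apply: cvgV; first by rewrite gt_eqF.
  by apply: cvgD; [exact: cvg_id|exact: cvg_cst].
- by rewrite add0r.
Qed.

Lemma powR_lt0_cvgy (R : realType) (alpha : R) : alpha < 0 ->
  c `^ alpha @[c --> 0^'+] --> (+oo : set_system R).
Proof.
move=> a0; apply/gtr0_cvgV0.
  near=> c; rewrite powR_gt0//; near: c; exact: nbhs_right_gt.
have := @powR_cvg0 R (- alpha); rewrite oppr_gt0 => /(_ a0).
by under eq_fun do rewrite powRN.
Unshelve. all: by end_near. Qed.

(** The error is the tail of the full half-line integral, bounded independently of [c] by dropping
    [c] from the denominator. *)
Lemma integral_powR_stieltjes_itvoo (R : realType) (alpha c d : R) :
  -1 < alpha < 0 -> 0 < c -> 0 < d -> exists2 j,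
  (\int[lebesgue_measure]_(s in `]0%R, d[) (s `^ alpha / (s + c))%:E = j%:E)%E &
  `|j - c `^ alpha * (pi / sin (pi * (alpha + 1)))| <= d `^ alpha / (- alpha).
Proof.
move=> /andP[a1 a0] c0 d0.
pose A : set (measurableTypeR R) := `]0, d[%classic.
pose B : set (measurableTypeR R) := `[d, +oo[%classic.
have mA : measurable A by exact: measurable_itv.
have mB : measurable B by exact: measurable_itv.
pose g s : R := s `^ alpha / (s + c).
have mg (D : set (measurableTypeR R)) : measurable_fun D (fun s => (g s)%:E).
  apply/measurable_EFinP/measurable_funTS/measurable_funM.
    exact: measurable_powR.
  exact: measurable_fun_invDr.
have Bpos s : B s -> 0 < s by rewrite /B/= in_itv/= andbT; exact: lt_le_trans.
have g0 s : 0 < s -> (0 <= (g s)%:E)%E.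
  by move=> s0; rewrite lee_fin divr_ge0 ?powR_ge0 ?addr_ge0 ?ltW.
have a01 : 0 < alpha + 1 < 1 by apply/andP; split; lra.
have tot := integral_powR_stieltjes a01 c0; rewrite addrK in tot.
have AB : `]0, +oo[%classic = A `|` B.
  by rewrite /A /B -itv_bndbnd_setU ?bnd_simp.
move: tot; rewrite AB ge0_integral_setU//.
- set I := (\int[_]_(s in A) _)%E; set T := (\int[_]_(s in B) _)%E => tot.
  have I0 : (0 <= I)%E.
    by apply: integral_ge0 => s; rewrite /A/= in_itv/= => /andP[/g0].
  have T0 : (0 <= T)%E by apply: integral_ge0 => s /Bpos/g0.
  have Td : (T <= (d `^ alpha / (- alpha))%:E)%E.
    have := @integral_powR_itvcy R (- alpha) d; rewrite opprK => <- //; last by rewrite oppr_gt0.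
    apply: ge0_le_integral => //.
    + by move=> s /Bpos/g0.
    + by apply/measurable_EFinP/measurable_funTS; exact: measurable_powR.
    + move=> s /Bpos s0; rewrite lee_fin powRB ?(gt_eqF s0) ?implybT// powRr1 ?(ltW s0)//.
      by rewrite /g ler_pM2l ?powR_gt0// lef_pV2 ?posrE ?addr_gt0// lerDl ltW.
  have Tfin : T \is a fin_num by rewrite ge0_fin_numE// (le_lt_trans Td)// ltry.
  have Ifin : I \is a fin_num.
    by rewrite ge0_fin_numE// (@le_lt_trans _ _ (I + T)%E) ?leeDl// tot ltry.
  exists (fine I); first by rewrite fineK.
  move: tot Td T0; rewrite -(fineK Ifin) -(fineK Tfin) -EFinD !lee_fin => -[<-] Td T0.
  by rewrite opprD addNKr normrN ger0_norm.
- by move=> s [|/Bpos/g0//]; rewrite /A/= in_itv/= => /andP[/g0].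
- rewrite disj_set2E; apply/eqP/seteqP; split => // s []; rewrite /A /B/= !in_itv/= andbT.
  by move=> /andP[_ /lt_le_trans sd] /sd; rewrite ltxx.
Qed.

(** Near 0 the density is at most [(C + 1) * s^alpha], and [s^(alpha - 1)] is integrable there; away
    from 0 the integrand is bounded. *)
Lemma expectation_inv_lty (R : realType) (mu : probability (measurableTypeR R) R)
    (f : R -> R) (C alpha : R) :
  mu (~` `]0, +oo[) = 0%E -> has_density mu f -> 0 <= C -> 0 < alpha ->
  (forall e : R, 0 < e -> \forall s \near 0^'+, `|f s - C * s `^ alpha| <= e * s `^ alpha) ->
  ('E_mu[fun s : R => (s^-1)%R] < +oo)%E.
Proof.
move=> mu0 dens C0 a0 fphi; have [mf f0 _] := dens.
have [d d0 fd] := near_at_right0 (fphi 1 ltr01).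
have [t [_ E]] := integral_inv_split dens (lexx 0) d0.
rewrite expectation_pos//; last exact: measurable_fun_invr.
have -> : (\int[mu]_(s in `]0%R, +oo[) (s^-1)%:E =
    \int[mu]_(s in `]0%R, +oo[) ((s + 0)^-1)%:E)%E.
  by apply: eq_integral => s _; rewrite addr0.
rewrite E lte_add_pinfty ?ltry//.
apply: (@le_lt_trans _ _ ((C + 1) * (d `^ alpha / alpha))%:E); last exact: ltry.
apply: (integral_density_le (phi := fun s => s `^ alpha)) => //.
- by move=> s; exact: powR_ge0.
- exact: addr_ge0.
- by move=> s /fd; rewrite ler_norml => /andP[_]; rewrite lerBlDl mulrDl.
rewrite -(integral_powR_itvoc a0 d0) -integral_itv_bndo_bndc.
  apply: eq_integral => s; rewrite inE/= in_itv/= => /andP[s0 _]; congr EFin.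
  by rewrite addr0 powRB ?(gt_eqF s0) ?implybT// powRr1// ltW.
by apply/measurable_EFinP/measurable_funTS; exact: measurable_powR.
Qed.

Theorem propositionF2 (R : realType) (sigma2 : R)
    (mu : probability (measurableTypeR R) R)
    (sigma2_gt0 : 0 < sigma2)
    (mu_supp : compactly_supported_on_nonneg mu)
    (mu_mean : (0 < 'E_mu[fun s : R => s])%E) :
  (* (i) *)
  ((exists q nu, zero_atom_decomposition mu q nu) /\
   (forall (q : R) (nu : probability (measurableTypeR R) R),
      zero_atom_decomposition mu q nu ->
      (forall w c : R, 0 < w -> c = sigma2 / w ->
         L sigma2 mu w = ((1 - q) * w + q * sigma2 * G nu c) /
                         (q * (1 - c * G nu c))) /\
      (q < 1 -> equiv_at_infty (L sigma2 mu) (fun w => (1 - q) / q * w))))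
  /\
  (* (ii) *)
  (mu [set 0] = 0%E -> ('E_mu[fun s : R => (s^-1)%R] < +oo)%E ->
   L sigma2 mu w @[w --> +oo] --> sigma2 * fine 'E_mu[fun s : R => (s^-1)%R])
  /\
  (* (iii) *)
  (forall (f : R -> R) (C alpha : R),
     mu [set 0] = 0%E ->
     has_density mu f ->
     0 < C -> -1 < alpha ->
     (forall s : R, f s = C * s `^ alpha +o_(s \near 0^'+) (s `^ alpha)) ->
     [/\ alpha = 0 ->
           equiv_at_infty (L sigma2 mu)
             (fun w => sigma2 * C * ln (w / sigma2)),
         -1 < alpha < 0 ->
           equiv_at_infty (L sigma2 mu)
             (fun w => sigma2 * C * (sigma2 / w) `^ alpha *
                       (pi / sin (pi * (alpha + 1)))) &
         0 < alpha ->
           ('E_mu[fun s : R => (s^-1)%R] < +oo)%E /\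
           L sigma2 mu w @[w --> +oo] -->
             sigma2 * fine 'E_mu[fun s : R => (s^-1)%R]]).
Proof.
have mu0 := compactly_supported_on_nonneg_lt0 mu_supp.
split; first split.
- exact: zero_atom_decomposition_exists.
- move=> q nu dec; split; last exact: (L_equiv_atom sigma2_gt0 mu0 dec).
  by move=> w c w0 ->; exact: (L_zero_atom sigma2_gt0 mu0 dec).
split; first by move=> mu00; exact: (L_cvg sigma2_gt0 mu0 mu00).
move=> f C alpha mu00 dens C0 alpha_gt flo.
have mu0' := zero_atom_decomposition_pos mu0 (zero_atom_decomposition_refl mu00).
have fphi e : 0 < e ->
    \forall s \near 0^'+, `|f s - C * s `^ alpha| <= e * s `^ alpha.
  (* The hypothesis is pointwise in [s]; [funext] assembles it into the identity of functions that
     unfolds to the epsilon form of little-o. *)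
  move=> e0; have /eqaddoP/(_ _ e0) := funext flo.
  apply: filterS => s; rewrite /= => h.
  rewrite -[X in _ <= _ * X](ger0_norm (powR_ge0 _ _)); exact: h.
have mphi : measurable_fun [set: R] (fun s : R => s `^ alpha) by exact: measurable_powR.
have phi0 (s : R) : 0 <= s `^ alpha by exact: powR_ge0.
have ratio := G_ratio_cvg mu0' dens mphi phi0 (ltW C0) fphi.
split=> [alpha0|/andP[_ alpha_lt0]|alpha_gt0].
- apply: (L_equiv sigma2_gt0 C0 mu0 mu00 (X := fun c => - ln c)).
    apply: ratio; first exact: Nln_cvgy.
    (* Since [0 < c < 1], the error [ln (d + c)] lies between [ln d] and [ln (d + 1)]. *)
    move=> d d0; exists (`|ln d| + `|ln (d + 1)|) => c /andP[c0 c1].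
    exists (ln (d + c) - ln c); first by rewrite alpha0 integral_log.
    rewrite opprK subrK.
    have h1 : ln d <= ln (d + c) by rewrite ler_ln ?posrE ?addr_gt0// lerDl ltW.
    have h2 : ln (d + c) <= ln (d + 1) by rewrite ler_ln ?posrE ?addr_gt0// lerD2l ltW.
    have := ler_norm (ln (d + 1)); have := ler_norm (- ln d); rewrite normrN.
    have := normr_ge0 (ln d); have := normr_ge0 (ln (d + 1)).
    move=> *; rewrite ler_norml; apply/andP; split; lra.
  by move=> w w0; rewrite -lnV ?posrE ?divr_gt0// invf_div.
- apply: (L_equiv sigma2_gt0 C0 mu0 mu00
    (X := fun c => c `^ alpha * (pi / sin (pi * (alpha + 1))))).
    apply: ratio.
      (* The constant is positive because [0 < alpha + 1 < 1], so the negative power makes [X]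
         diverge. *)
      apply: gt0_cvgMly; last exact: powR_lt0_cvgy.
      have p0 := pi_gt0 R; rewrite divr_gt0// sin_gt0_pi//.
      by apply/andP; split; nra.
    move=> d d0; exists (d `^ alpha / (- alpha)) => c /andP[c0 _].
    by apply: integral_powR_stieltjes_itvoo => //; rewrite alpha_gt.
  by move=> w w0; rewrite -!mulrA.
- have fin := expectation_inv_lty mu0' dens (ltW C0) alpha_gt0 fphi.
  by split; [exact: fin|exact: (L_cvg sigma2_gt0 mu0 mu00 fin)].
Qed.
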